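(* Let $P:V_{\rm rec}\to V_{\rm op}$ be the linear projection from the space of channel-resolved memory kernels to the space of memory kernels labelled only by the Majorana bilinear, $$(PK)_{jk}^{>,<}(t)=\sum_{r,s}K_{jr,ks}^{>,<}(t)\qquad (j<k).$$ A transport observable $O[K]$, $K\in V_{\rm rec}$, is reconstructible from the non-Markovian island-state dynamics if and only if it is constant on every fiber of $P$, i.e. for all $K^A,K^B\in V_{\rm rec}$, $$PK^A=PK^B\ \Longrightarrow\ O[K^A]=O[K^B].$$ Moreover, if $O$ is differentiable, this fiber-constancy condition implies $$\delta O[\delta K]=0\quad\text{for all }\ \delta K\in\ker P,$$ where $$\ker P=\Big\{\delta K\in V_{\rm rec}:\ \sum_{r,s}\delta K_{jr,ks}^{>,<}(t)=0\ \text{ for all } j<k \text{ and all } t\Big\}.$$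
   Context: Setting: a floating island with $M$ Majorana zero modes $\gamma_1,\dots,\gamma_M$ is coupled at contact $j$ to reservoir channels labelled by $r$. A cotunneling event transferring an electron between channel $ks$ (channel $s$ at contact $k$) and channel $jr$ (channel $r$ at contact $j$), $j<k$, acts on the island through the Majorana bilinear $S_{jk}=i\gamma_j\gamma_k$. $V_{\rm rec}$ is the vector space of families of kernels with explicit lead and channel labels, $K=\big(K_{jr,ks}^{>}(t),K_{jr,ks}^{<}(t)\big)_{j<k;\,r,s}$, functions of the memory time $t\ge 0$. $V_{\rm op}$ is the vector space of families of kernels $\big(K_{jk}^{>}(t),K_{jk}^{<}(t)\big)_{j<k}$ labelled only by the pair $j<k$. The superscript ''$>,<$'' means that the formula holds separately for the ''$>$'' component and for the ''$<$'' component. The sums over $r,s$ run over the channels of contacts $j$ and $k$ respectively. The island-state dynamics depends on $K$ only through the projected kernels $PK$. A transport observable is a functional $O$ on $V_{\rm rec}$. It is called reconstructible from the non-Markovian island-state dynamics if there is a functional $\bar O$ of projected kernels (defined on the image of $P$) such that $O[K]=\bar O[PK]$ for all $K\in V_{\rm rec}$. $\delta O[\delta K]$ denotes the derivative of $O$ at a point $K$ in the direction $\delta K$, $\delta O[\delta K]=\frac{d}{d\epsilon}O[K+\epsilon\,\delta K]\big|_{\epsilon=0}$; the stated vanishing holds at every $K\in V_{\rm rec}$. *)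

(* Defs.v *)
From HB Require Import structures.
From mathcomp Require Import all_boot all_order all_algebra.
From mathcomp Require Import all_classical all_reals all_analysis.
From mathcomp.real_closed Require Export complex.

Set Implicit Arguments.
Unset Strict Implicit.
Unset Printing Implicit Defensive.

Import Order.TTheory GRing.Theory Num.Theory numFieldNormedType.Exports.

Local Open Scope classical_set_scope.
Local Open Scope ring_scope.
Local Open Scope complex_scope.

(* The label j < k of the Majorana bilinear S_jk = i gamma_j gamma_k. *)
Definition bilinear_label (M : nat) : Type := {p : 'I_M * 'I_M | (p.1 < p.2)%N}.

Definition contact1 (M : nat) (jk : bilinear_label M) : 'I_M := (val jk).1.
Definition contact2 (M : nat) (jk : bilinear_label M) : 'I_M := (val jk).2.

(* [Ch j] is the finite type of reservoir channels at contact j. *)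
Definition channel_pair (M : nat) (Ch : 'I_M -> finType)
    (jk : bilinear_label M) : Type :=
  (Ch (contact1 jk) * Ch (contact2 jk))%type.

(* The label (jr, ks), j < k, of a channel-resolved cotunneling event. *)
Definition cotunneling (M : nat) (Ch : 'I_M -> finType) : Type :=
  {jk : bilinear_label M & channel_pair Ch jk}.

Definition mk_cotunneling (M : nat) (Ch : 'I_M -> finType)
    (jk : bilinear_label M) (r : Ch (contact1 jk)) (s : Ch (contact2 jk)) :
  cotunneling Ch :=
  existT (channel_pair Ch) jk (r, s).

(* The two kernel components, written with the superscripts > and <. *)
Inductive kernel_component : Type := Greater | Lesser.

Definition V_rec (R : realType) (M : nat) (Ch : 'I_M -> finType) :
  lmodType R[i] := (cotunneling Ch -> kernel_component -> {nonneg R} -> R[i]).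

Definition V_op (R : realType) (M : nat) : lmodType R[i] :=
  (bilinear_label M -> kernel_component -> {nonneg R} -> R[i]).

Definition proj_kernel (R : realType) (M : nat) (Ch : 'I_M -> finType)
    (K : V_rec R Ch) : V_op R M :=
  fun jk c t =>
    \sum_(r : Ch (contact1 jk)) \sum_(s : Ch (contact2 jk))
      K (mk_cotunneling r s) c t.

Lemma proj_kernel_is_linear (R : realType) (M : nat) (Ch : 'I_M -> finType) :
  linear (@proj_kernel R M Ch).
Proof.
move=> a K L; apply/funext => jk; apply/funext => c; apply/funext => t.
rewrite [RHS]/(a * proj_kernel K jk c t + proj_kernel L jk c t) /proj_kernel.
under eq_bigr do rewrite big_split /= -mulr_sumr.
by rewrite big_split /= -mulr_sumr.
Qed.

HB.instance Definition _ (R : realType) (M : nat) (Ch : 'I_M -> finType) :=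
  GRing.isLinear.Build R[i] (V_rec R Ch) (V_op R M) _ (@proj_kernel R M Ch)
    (@proj_kernel_is_linear R M Ch).

Definition ker_proj (R : realType) (M : nat) (Ch : 'I_M -> finType) :
  set (V_rec R Ch) := @proj_kernel R M Ch @^-1` [set 0].

Definition observable (R : realType) (M : nat) (Ch : 'I_M -> finType) : Type :=
  V_rec R Ch -> R[i].

Definition to_image (R : realType) (M : nat) (Ch : 'I_M -> finType)
    (K : V_rec R Ch) : range (@proj_kernel R M Ch) :=
  SigSub (mem_set (imageT (@proj_kernel R M Ch) K)).

Definition reconstructible (R : realType) (M : nat) (Ch : 'I_M -> finType)
    (O : observable R Ch) : Prop :=
  exists Obar : range (@proj_kernel R M Ch) -> R[i],
    forall K : V_rec R Ch, O K = Obar (to_image K).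

Definition fiber_constant (R : realType) (M : nat) (Ch : 'I_M -> finType)
    (O : observable R Ch) : Prop :=
  forall KA KB : V_rec R Ch, proj_kernel KA = proj_kernel KB -> O KA = O KB.

(* The parameter e is real while O is complex-valued, so that the quotient is
   not an instance of the one in [derive], where both share their scalars;
   [^o] provides the norm topology on R[i]. *)
Definition diff_quotient (R : realType) (M : nat) (Ch : 'I_M -> finType)
    (O : observable R Ch) (K dK : V_rec R Ch) (e : R) : (R[i])^o :=
  (e^-1)%:C * (O (K + e%:C *: dK) - O K).

(* Only directional differentiability is asked for: V_rec has no topology, and
   the directional derivatives exist under any stronger notion. *)
Definition differentiable_observable (R : realType) (M : nat)
    (Ch : 'I_M -> finType) (O : observable R Ch) : Prop :=
  forall K dK : V_rec R Ch, cvg (diff_quotient O K dK @ 0^').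

(* d/de O[K + e dK] at e = 0; meaningful when the limit exists. *)
Definition obs_derivative (R : realType) (M : nat) (Ch : 'I_M -> finType)
    (O : observable R Ch) (K dK : V_rec R Ch) : R[i] :=
  lim (diff_quotient O K dK @ 0^').

(* Main.v *)
Require Import Defs.
From mathcomp Require Import all_boot all_order all_algebra.
From mathcomp Require Import all_classical all_reals all_analysis.

Local Open Scope classical_set_scope.
Local Open Scope ring_scope.

Import GRing.Theory numFieldNormedType.Exports.

(** A map factors through the image of [proj_kernel] exactly when it is constant on fibers: this is
    set theory, and linearity plays its part only for derivatives ([reconstructibleP]). By
    linearity, a line through [K] in a kernel direction stays inside the fiber of [K], so a
    fiber-constant [O] does not vary along it and its derivative there is zero
    ([fiber_constant_obs_derivative]). *)

Section ProjectedKernels.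
Context {R : realType} {M : nat} {Ch : 'I_M -> finType}.
Implicit Types (O : observable R Ch) (K dK : V_rec R Ch).

Lemma to_image_eq K L :
  to_image K = to_image L <-> proj_kernel K = proj_kernel L.
Proof. by split=> [/(congr1 val)|KL] //; apply: val_inj. Qed.

Lemma reconstructibleP O : reconstructible O <-> fiber_constant O.
Proof.
split=> [[Obar ObarE] KA KB /to_image_eq KAB|Oconst].
  by rewrite !ObarE KAB.
(* Choice picks one preimage for each point of the image; fiber constancy makes the value of [O] on
   it independent of that choice. *)
have lift (y : range (@proj_kernel R M Ch)) :
    {K : V_rec R Ch | proj_kernel K = val y}.
  by apply: cid; have [K _ Ky] := set_mem (valP y); exists K.
exists (fun y => O (sval (lift y))) => K.
by apply: Oconst; rewrite (svalP (lift _)).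
Qed.

Lemma proj_kernelD_ker K dK (a : complex R) :
  ker_proj dK -> proj_kernel (K + a *: dK) = proj_kernel K.
Proof.
move=> dK0; rewrite addrC; have /= -> := @proj_kernel_is_linear R M Ch a dK K.
have -> : proj_kernel dK = 0 by exact: dK0.
by rewrite scaler0 add0r.
Qed.

(** Both values of [O] are taken in one fiber, so the difference cancels for every [e], before any
    limit. *)
Lemma fiber_constant_diff_quotient O K dK :
  fiber_constant O -> ker_proj dK -> diff_quotient O K dK = cst 0.
Proof.
move=> Oconst dK0; apply/funext => e.
rewrite /diff_quotient (Oconst _ K) ?subrr ?mulr0 //.
exact: proj_kernelD_ker.
Qed.

Lemma fiber_constant_obs_derivative O K dK :
  fiber_constant O -> ker_proj dK -> obs_derivative O K dK = 0.
Proof.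
move=> Oconst dK0.
rewrite /obs_derivative fiber_constant_diff_quotient //.
(* [lim] is a chosen limit point; the norm topology being Hausdorff forces it to be 0. *)
by apply: (@lim_cst (complex R)^o); apply: norm_hausdorff.
Qed.

Lemma ker_projP dK :
  ker_proj dK <-> forall jk c t,
    \sum_(r : Ch (contact1 jk)) \sum_(s : Ch (contact2 jk))
      dK (mk_cotunneling r s) c t = 0.
Proof.
split=> [dK0 jk c t|dK0].
  exact: (congr1 (fun k : V_op R M => k jk c t) dK0).
by apply/funext => jk; apply/funext => c; apply/funext => t; apply: dK0.
Qed.

End ProjectedKernels.

Theorem theorem2 (R : realType) (M : nat) (Ch : 'I_M -> finType) :
  (forall O : observable R Ch, reconstructible O <-> fiber_constant O) /\
  (forall O : observable R Ch,
     differentiable_observable O -> fiber_constant O ->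
     forall K dK : V_rec R Ch, ker_proj dK -> obs_derivative O K dK = 0) /\
  @ker_proj R M Ch =
    [set dK : V_rec R Ch |
      forall (jk : bilinear_label M) (c : kernel_component) (t : {nonneg R}),
        \sum_(r : Ch (contact1 jk)) \sum_(s : Ch (contact2 jk))
          dK (mk_cotunneling r s) c t = 0].
Proof.
split; first exact: reconstructibleP.
split; first by move=> O _ Oconst K dK; apply: fiber_constant_obs_derivative.
by apply/funext => dK; apply/propext; apply: ker_projP.
Qed.
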